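(* Let $k\ge 2$ and let $G$ be an irregular connected $k$-uniform hypergraph with $n$ vertices and $m$ edges, maximum degree $\Delta$, diameter $D$ and spectral radius $\rho(G)$. Then $$\rho(G)<\frac{2m\Delta(k-1)D(n\Delta-km)+km\Delta}{2m(k-1)D(n\Delta-km)+n\Delta}.$$
   Context: A $k$-uniform hypergraph $G$ has a finite vertex set $V(G)=\{1,\dots,n\}$ and a set $E(G)$ of edges, each of which is a set of exactly $k$ distinct vertices. The degree $d_i$ of a vertex $i$ is the number of edges containing $i$; $\Delta=\max_i d_i$. $G$ is regular if all vertices have the same degree, and irregular otherwise. A path from $u$ to $v$ is an alternating sequence $v_0e_1v_1e_2\cdots v_{l-1}e_lv_l$ with $v_0=u$, $v_l=v$, where the vertices $v_0,\dots,v_l$ are distinct, the edges $e_1,\dots,e_l$ are distinct, and $v_{i-1},v_i\in e_i$ for $i=1,\dots,l$; its length is $l$. $G$ is connected if there is a path between any two vertices. The distance between two distinct vertices is the length of a shortest path connecting them, and the diameter $D$ is the maximum distance between vertices of $G$. The adjacency tensor of $G$ is $\mathcal{A}_G=(a_{i_1\cdots i_k})$, of order $k$ and dimension $n$, with $a_{i_1\cdots i_k}=\frac{1}{(k-1)!}$ if $\{i_1,\dots,i_k\}\in E(G)$ and $a_{i_1\cdots i_k}=0$ otherwise. For $x\in\mathbb{C}^n$, $\mathcal{A}_Gx^{k-1}\in\mathbb{C}^n$ has $i$-th component $\sum_{i_2,\dots,i_k=1}^n a_{ii_2\cdots i_k}x_{i_2}\cdots x_{i_k}$. A number $\lambda\in\mathbb{C}$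 is an eigenvalue of $\mathcal{A}_G$ with eigenvector $x\in\mathbb{C}^n\setminus\{0\}$ if $\mathcal{A}_Gx^{k-1}=\lambda x^{[k-1]}$, where $x^{[k-1]}=(x_1^{k-1},\dots,x_n^{k-1})^{\mathrm T}$. The spectral radius $\rho(G)$ is the maximum modulus of the eigenvalues of $\mathcal{A}_G$. *)

(* Defs.v *)
From HB Require Import structures.
From mathcomp Require Import all_boot all_order all_algebra.
From mathcomp Require Import boolp classical_sets reals.
From mathcomp.real_closed Require Import complex.

Set Implicit Arguments.
Unset Strict Implicit.
Unset Printing Implicit Defensive.

Import Order.TTheory GRing.Theory Num.Theory.

Local Open Scope ring_scope.

Record uniform_hypergraph (n k : nat) := UniformHypergraph {
  edges : {set {set 'I_n}};
  card_edge : forall e, e \in edges -> #|e| = k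
}.

Definition size_hypergraph n k (G : uniform_hypergraph n k) : nat := #|edges G|.

Definition degree n k (G : uniform_hypergraph n k) (i : 'I_n) : nat :=
  #|[set e in edges G | i \in e]|.

Definition max_degree n k (G : uniform_hypergraph n k) : nat :=
  \max_(i < n) degree G i.

Definition regular n k (G : uniform_hypergraph n k) : Prop :=
  forall i j, degree G i = degree G j.

Definition irregular n k (G : uniform_hypergraph n k) : Prop := ~ regular G.

(* [vs] lists v_0, ..., v_l and [es] lists e_1, ..., e_l, so e_(i+1) is entry i
   of [es]. *)
Definition is_hpath n k (G : uniform_hypergraph n k) (u v : 'I_n) (l : nat)
    (vs : l.+1.-tuple 'I_n) (es : l.-tuple {set 'I_n}) : bool :=
  [&& thead vs == u, tnth vs ord_max == v, uniq vs, uniq es,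
      all (mem (edges G)) es
    & [forall i : 'I_l,
        (tnth vs (widen_ord (leqnSn l) i) \in tnth es i)
        && (tnth vs (lift ord0 i) \in tnth es i)]].

Definition has_hpath n k (G : uniform_hypergraph n k) (u v : 'I_n) (l : nat)
  : bool :=
  [exists vs : l.+1.-tuple 'I_n, exists es : l.-tuple {set 'I_n},
     is_hpath G u v vs es].

Definition hconnected n k (G : uniform_hypergraph n k) : Prop :=
  forall u v, exists l, has_hpath G u v l.

(* Vertices of a path are distinct, so lengths are less than n: bounding l loses
   no path, and the value n is only taken when no path exists. *)
Definition distance n k (G : uniform_hypergraph n k) (u v : 'I_n) : nat :=
  \big[minn/n]_(l < n | has_hpath G u v l) l.

Definition diameter n k (G : uniform_hypergraph n k) : nat :=
  \max_(u < n) \max_(v < n | v != u) distance G u v.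

(* The entry a_(i_1 i_2 ... i_k) of [a : tensor T n k] is
   [a i_1 [tuple i_2; ...; i_k]]; k is meant to be positive. *)
Definition tensor (T : Type) (n k : nat) := 'I_n -> k.-1.-tuple 'I_n -> T.

Definition tensor_apply (C : comNzRingType) n k (a : tensor C n k)
    (x : 'cV[C]_n) : 'cV[C]_n :=
  \col_i \sum_(t : k.-1.-tuple 'I_n) a i t * \prod_(j <- t) x j 0.

Definition tensor_eigenvalue (C : fieldType) n k (a : tensor C n k) (lam : C)
  : Prop :=
  exists2 x : 'cV[C]_n, x != 0 &
    tensor_apply a x = lam *: map_mx (fun z => z ^+ k.-1) x.

Definition adjacency_tensor (C : fieldType) n k (G : uniform_hypergraph n k)
  : tensor C n k :=
  fun i t => if [set j in i :: t] \in edges G then (k.-1)`!%:R^-1 else 0.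

(* The eigenvalues form a nonempty finite set when n >= 1 and k >= 2, so this
   supremum is then a maximum. *)
Definition spectral_radius (R : realType) n k (G : uniform_hypergraph n k) : R :=
  sup [set r : R | exists2 lam : R[i],
    tensor_eigenvalue (adjacency_tensor R[i] G) lam & r = Normc.normc lam]%classic.

(* Main.v *)
Require Import Defs.
From mathcomp Require Import all_boot all_order all_algebra.
From mathcomp Require Import boolp reals.
From mathcomp Require Import lra ring.
From mathcomp.real_closed Require Import complex.

Set Implicit Arguments.
Unset Strict Implicit.
Unset Printing Implicit Defensive.

Import Order.TTheory GRing.Theory Num.Theory.

Local Open Scope ring_scope.

(** Let x be an eigenvector for lam, w_i = sqrt |x_i| and z_i = w_i ^ k.  The
    triangle inequality in the eigenvalue equation gives |lam| T <= g with
    T = sum_i z_i ^ 2 and g = k sum_e prod_(i in e) w_i ^ 2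
    ([eigenvalue_normc_le]), so it is enough to bound the quotient g / T over
    all nonnegative nonzero w.  This avoids Perron-Frobenius theory: lam need
    not be the spectral radius and x need not be positive.

    The double counting of degrees gives ([energy_split])
      Delta T - g = sum_i (Delta - d_i) z_i ^ 2
                    + sum_e (sum_(i in e) z_i ^ 2 - k prod_(i in e) w_i ^ 2).
    The weights Delta - d_i have the sum S = n Delta - k m > 0, so the first
    part is at least S t ^ 2, where t is the smallest z_i.  By the inequality of
    arithmetic and geometric means applied to the products z_i z_j, the summand
    of e in the second part is at least k / (2 (k - 1)) (z_p - z_q) ^ 2 for all
    p, q in e ([edge_gap]).  The factor k comes from the vertices of e other
    than p and q, which contribute as well.  Scale w so that its maximum is 1,
    and follow a shortest path from a vertex where z is 1 to one where it is t:
    by Cauchy-Schwarz, the second part phi satisfies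
      k (1 - t) ^ 2 <= c phi, with c = 2 (k - 1) D.
    Finally g <= k m - (1 - t), because all w_i are at most 1 and some edge
    contains a vertex where z is t ([sum_prod_le]).

    With B = c S + k, these three inequalities combine to
      m B Delta T - g (m B + S) >= m / c (B t - k) ^ 2 + S (1 - t),
    and m B Delta / (m B + S) is exactly the bound of the theorem.  The right
    side is positive on t <= 1: its square vanishes only at t = k / B < 1.  Its
    minimum depends on the hypergraph only ([linear_bound]), which gives a gap
    uniform in lam, and so the strict inequality survives in the supremum that
    defines the spectral radius. *)

(** * Adjacency tensor and moduli of eigenvalues *)

(** As [e] has exactly [k] elements, [k] entries can only cover it without
    repetition; this reduces the tuples with image [e] to duplicate-free ones. *)
Lemma edge_tuples n k (G : uniform_hypergraph n k) (e : {set 'I_n})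
    (i : 'I_n) (t : k.-1.-tuple 'I_n) : e \in edges G -> i \in e ->
  ([set j in i :: t] == e) = all (mem (e :\ i)) t && uniq t.
Proof.
move=> eE ie; have ke := card_edge eE.
have k0 : (0 < k)%N by rewrite -ke; apply/card_gt0P; exists i.
have sz : size (i :: t) = #|e| by rewrite /= size_tuple ke prednK.
apply/eqP/idP => [te|/andP[/allP tA tU]].
  have : uniq (i :: t).
    apply/card_uniqP; rewrite sz -te cardsE; apply: eq_card => j.
    by rewrite !inE.
  rewrite /= => /andP[it ->]; rewrite andbT; apply/allP => j jt /=.
  rewrite !inE -te !inE jt orbT andbT.
  by apply: contraNneq it => <-.
apply/eqP; rewrite eqEcard; apply/andP; split.
  apply/subsetP => j; rewrite !inE => /orP[/eqP->//|/tA].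
  by rewrite /= !inE => /andP[].
rewrite -sz cardsE; suff /card_uniqP -> : uniq (i :: t) by [].
rewrite /= tU andbT; apply/negP => /tA.
by rewrite /= !inE eqxx.
Qed.

(** Each edge through [i] is met once for each ordering of its other [k - 1]
    vertices, which the weight 1 / (k - 1)! of the tensor cancels. *)
Lemma adjacency_apply (C : numFieldType) n k (G : uniform_hypergraph n k)
    (x : 'cV[C]_n) (i : 'I_n) :
  tensor_apply (adjacency_tensor C G) x i 0 =
  \sum_(e in edges G | i \in e) \prod_(j in e :\ i) x j 0.
Proof.
rewrite mxE /adjacency_tensor.
under eq_bigr do rewrite (fun_if (fun z => z * _)) mul0r.
rewrite -big_mkcond /=.
rewrite (partition_big (fun t : k.-1.-tuple 'I_n => [set j in i :: t])
  (fun e => (e \in edges G) && (i \in e))) /=; last first.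
  by move=> t ->; rewrite !inE eqxx.
apply: eq_bigr => e /andP[eE ie].
transitivity (\sum_(t in [set t : k.-1.-tuple 'I_n |
    all (mem (e :\ i)) t & uniq t])
  ((k.-1)`!%:R^-1 : C) * \prod_(j in e :\ i) x j 0).
  apply: eq_big => [t|t /andP[_ te]].
    rewrite inE -(edge_tuples _ eE ie).
    by case: eqP => [->|]; rewrite ?eE ?andbF.
  congr (_ * _); move: te; rewrite (edge_tuples _ eE ie) => /andP[/allP tA tU].
  rewrite big_uniq //=; apply: eq_bigl => j.
  have /subset_cardP -> // : t \subset e :\ i by apply/subsetP=> ? /tA.
  rewrite (card_uniqP tU) size_tuple; have := cardsD1 i e.
  by rewrite ie (card_edge eE) => ->.
rewrite sumr_const card_uniq_tuples.
have -> : #|(mem (e :\ i))| = k.-1.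
  by have := cardsD1 i e; rewrite ie (card_edge eE) => ->.
rewrite ffactnn -[LHS]mulr_natl mulrA divff ?mul1r //.
by rewrite pnatr_eq0 -lt0n fact_gt0.
Qed.

Lemma handshake (R : comRingType) n k (G : uniform_hypergraph n k)
    (a : 'I_n -> R) :
  \sum_i (degree G i)%:R * a i = \sum_(e in edges G) \sum_(i in e) a i.
Proof.
rewrite (exchange_big_dep predT) //=; apply: eq_bigr => i _.
rewrite sumr_const mulr_natl; congr (_ *+ _).
by rewrite /degree cardsE.
Qed.

Lemma handshake_size (R : comRingType) n k (G : uniform_hypergraph n k) :
  \sum_i (degree G i)%:R = k%:R * (size_hypergraph G)%:R :> R.
Proof.
under eq_bigr do rewrite -[_%:R]mulr1.
rewrite handshake (eq_bigr (fun=> k%:R)) ?sumr_const ?mulr_natr //.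
by move=> e eE; rewrite sumr_const (card_edge eE).
Qed.

(** Take moduli in row [i] of the eigenvalue equation, multiply by [`|x i 0|]
    and sum over [i]: each edge is then counted once for each of its vertices. *)
Lemma eigenvalue_norm_le (C : numFieldType) n k (G : uniform_hypergraph n k)
    (lam : C) (x : 'cV[C]_n) : (0 < k)%N ->
  tensor_apply (adjacency_tensor C G) x =
    lam *: map_mx (fun z => z ^+ k.-1) x ->
  `|lam| * \sum_i `|x i 0| ^+ k <=
    k%:R * \sum_(e in edges G) \prod_(i in e) `|x i 0|.
Proof.
move=> k0 /matrixP eig.
have row i : `|lam| * `|x i 0| ^+ k <=
    \sum_(e in edges G | i \in e) \prod_(j in e) `|x j 0|.
  have := eig i 0; rewrite adjacency_apply !mxE => /(congr1 Num.norm).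
  rewrite normrM normrX => H.
  rewrite -[X in _ ^+ X](prednK k0) exprS mulrCA -H.
  apply: (le_trans (ler_wpM2l (normr_ge0 _) (ler_norm_sum _ _ _))).
  rewrite mulr_sumr; apply: ler_sum => e /andP[_ ie].
  by rewrite normr_prod [leRHS](big_setD1 i).
rewrite mulr_sumr (le_trans (ler_sum _ (fun i _ => row i))) //.
rewrite (exchange_big_dep (mem (edges G))) //=; last by move=> i e _ /andP[].
rewrite mulr_sumr; apply: ler_sum => e eE.
rewrite (eq_bigl (mem e)); last by move=> i; rewrite eE.
by rewrite sumr_const (card_edge eE) mulr_natl.
Qed.

(** * Inequalities on one edge *)

(** The right side is [2 * #|A|] times the sum of the squared deviations from
    the mean, and for p <> q the two deviations at [p] and [q] alone contribute
    at least (z p - z q)^2 / 2 to that sum. *)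
Lemma spread_le_variance (R : realFieldType) (I : finType) (A : {set I})
    (z : I -> R) (p q : I) : p \in A -> q \in A ->
  #|A|%:R * (z p - z q) ^+ 2 <=
    2 * (#|A|%:R * \sum_(i in A) z i ^+ 2 - (\sum_(i in A) z i) ^+ 2).
Proof.
move=> pA qA; set s := \sum_(i in A) z i; set Q := \sum_(i in A) _.
have K0 : 0 < #|A|%:R :> R by rewrite ltr0n; apply/card_gt0P; exists p.
set K : R := #|A|%:R in K0 *; pose mu := s / K.
have sumE : \sum_(i in A) (z i - mu) ^+ 2 = Q - mu * s.
  have : \sum_(i in A) (z i - mu) ^+ 2 = Q - 2 * mu * s + K * mu ^+ 2.
    transitivity (\sum_(i in A) (z i ^+ 2 - 2 * mu * z i + mu ^+ 2)).
      by apply: eq_bigr => i _; ring.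
    rewrite big_split sumrB /= -mulr_sumr sumr_const -/s -/Q.
    by rewrite -[X in _ + X = _]mulr_natl.
  by move=> ->; rewrite /mu; field; rewrite gt_eqF.
have varE : K * Q - s ^+ 2 = K * \sum_(i in A) (z i - mu) ^+ 2.
  by rewrite sumE /mu; field; rewrite gt_eqF.
rewrite varE [leRHS]mulrCA ler_pM2l //.
have [->|npq] := eqVneq p q.
  by rewrite subrr expr0n mulr_ge0 // sumr_ge0 // => i _; rewrite sqr_ge0.
rewrite (big_setD1 p) //= (big_setD1 q) ?inE ?qA 1?eq_sym ?npq //=.
have : 0 <= \sum_(i in A :\ p :\ q) (z i - mu) ^+ 2.
  by rewrite sumr_ge0 // => i _; rewrite sqr_ge0.
set r := \sum_(i in _) _ => r0.
by have := sqr_ge0 ((z p - mu) + (z q - mu)); nra.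
Qed.

(** The right side is the sum of the products w i ^ k * w j ^ k over the ordered
    pairs i <> j, with k = [#|A|].  In the product of these k (k - 1) terms each
    [w i] has exponent 2 k (k - 1), so their geometric mean is the product of
    the [w i ^+ 2]. *)
Lemma AGM_pairs (R : realFieldType) (I : finType) (A : {set I}) (w : I -> R) :
    (forall i, 0 <= w i) -> (1 < #|A|)%N ->
  (#|A|%:R * (#|A|%:R - 1)) * \prod_(i in A) w i ^+ 2 <=
    (\sum_(i in A) w i ^+ #|A|) ^+ 2 - \sum_(i in A) (w i ^+ #|A|) ^+ 2.
Proof.
move=> w0 A1; set k := #|A| in A1 *.
pose B := [set p : I * I | (p.1 \in A) && (p.2 \in A :\ p.1)].
pose E (p : I * I) := w p.1 ^+ k * w p.2 ^+ k.
have E0 p : 0 <= E p by rewrite mulr_ge0 ?exprn_ge0.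
have cardD i : i \in A -> #|A :\ i| = k.-1.
  by move=> iA; rewrite /k (cardsD1 i A) iA.
have cardB : #|B| = (k * k.-1)%N.
  rewrite -sum1dep_card -(pair_big_dep (mem A) (fun i j => j \in A :\ i)
    (fun _ _ => 1%N)) /= -sum_nat_const; apply: eq_bigr => i iA.
  by rewrite sum1_card cardD.
have sumE : \sum_(p in B) E p =
    (\sum_(i in A) w i ^+ k) ^+ 2 - \sum_(i in A) (w i ^+ k) ^+ 2.
  rewrite (eq_bigl (fun p => (p.1 \in A) && (p.2 \in A :\ p.1))); last first.
    by move=> p; rewrite inE.
  rewrite -(pair_big_dep (mem A) (fun i j => j \in A :\ i)
    (fun i j => w i ^+ k * w j ^+ k)) /=.
  rewrite expr2 mulr_suml -sumrB; apply: eq_bigr => i iA.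
  by rewrite -mulr_sumr -mulrBr (big_setD1 i iA) /=; congr (_ * _); ring.
have prodE : \prod_(p in B) E p =
    (\prod_(i in A) w i ^+ 2) ^+ #|B|.
  rewrite (eq_bigl (fun p => (p.1 \in A) && (p.2 \in A :\ p.1))); last first.
    by move=> p; rewrite inE.
  rewrite -(pair_big_dep (mem A) (fun i j => j \in A :\ i)
    (fun i j => w i ^+ k * w j ^+ k)) /=.
  have half : \prod_(i in A) \prod_(j in A :\ i) w i ^+ k =
      (\prod_(i in A) w i) ^+ #|B|.
    rewrite cardB -prodrXl; apply: eq_bigr => i iA.
    by rewrite prodr_const cardD // exprM.
  under eq_bigr do rewrite big_split /=.
  rewrite big_split /= half.
  rewrite (exchange_big_dep (mem A)) /=; last first.
    by move=> i j _; rewrite !inE => /andP[].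
  rewrite [X in _ * X](eq_bigr (fun j => \prod_(i in A :\ j) w j ^+ k));
    last first.
    move=> j jA; apply: eq_bigl => i; rewrite !inE jA andbT eq_sym.
    by rewrite andbC.
  by rewrite half prodrXl -expr2 -!exprM mulnC.
(* The inequality of the means compares #|B|-th powers; the root can be
   taken because both sides are nonnegative. *)
have B0 : (0 < #|B|)%N by rewrite cardB muln_gt0 -subn1 subn_gt0 A1 ltnW.
have B0R : 0 < #|B|%:R :> R by rewrite ltr0n.
have := (leif_AGM (A := B) (fun p _ => E0 p)).1; rewrite prodE.
have P0 : 0 <= \prod_(i in A) w i ^+ 2.
  by rewrite prodr_ge0 // => i _; rewrite sqr_ge0.
rewrite ler_pXn2r ?nnegrE ?divr_ge0 ?sumr_ge0 //.
by rewrite ler_pdivlMr // sumE cardB natrM -subn1 natrB 1?ltnW // mulrC.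
Qed.

(** An edge whose contribution to the energy is small carries nearly constant
    values.  [AGM_pairs] replaces the product by a quadratic form in the
    w i ^ k, which is a multiple of their variance. *)
Lemma edge_gap (R : realFieldType) (I : finType) (A : {set I}) (w : I -> R)
    (p q : I) : (forall i, 0 <= w i) -> (1 < #|A|)%N -> p \in A -> q \in A ->
  #|A|%:R * (w p ^+ #|A| - w q ^+ #|A|) ^+ 2 <=
    2 * (#|A|%:R - 1) * (\sum_(i in A) (w i ^+ #|A|) ^+ 2
                         - #|A|%:R * \prod_(i in A) w i ^+ 2).
Proof.
move=> w0 A1 pA qA.
have := spread_le_variance (fun i => w i ^+ #|A|) pA qA.
have := AGM_pairs w0 A1.
set Q := \sum_(i in A) _ ^+ 2; set P := \prod_(i in A) _.
set s := \sum_(i in A) _.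
move: (_ - _) #|A|%:R P Q s => d K P Q s; lra.
Qed.

(** Cauchy-Schwarz against the constant 1, as nonnegativity of a variance. *)
Lemma sqr_sum_le (R : realFieldType) (l : nat) (c : 'I_l -> R) :
  (\sum_i c i) ^+ 2 <= l%:R * \sum_i c i ^+ 2.
Proof.
case: l c => [|l] c; first by rewrite !big_ord0 expr0n mulr0.
have := @spread_le_variance R _ setT c ord0 ord0 (in_setT _) (in_setT _).
rewrite subrr expr0n mulr0 pmulr_rge0 // subr_ge0 cardsT card_ord.
have sumT (f : 'I_l.+1 -> R) : \sum_(i in setT) f i = \sum_i f i.
  by apply: eq_bigl => i; rewrite inE.
by rewrite !sumT.
Qed.

(** * Paths, degrees and energy *)

Lemma hpath_gt0 n k (G : uniform_hypergraph n k) (u v : 'I_n) l :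
  u != v -> has_hpath G u v l -> (0 < l)%N.
Proof.
move=> uv /existsP[vs /existsP[es /and5P[/eqP vsu /eqP vsv _ _ _]]].
rewrite lt0n; apply: contraNneq uv => l0; rewrite -vsu -vsv.
rewrite /thead; apply/eqP; congr tnth; apply: val_inj; by rewrite /= l0.
Qed.

Lemma hpath_edge n k (G : uniform_hypergraph n k) (u v : 'I_n) l :
  u != v -> has_hpath G u v l -> exists2 e, e \in edges G & u \in e.
Proof.
move=> uv pl; have l0 := hpath_gt0 uv pl.
have /existsP[vs /existsP[es]] := pl.
case/and5P => /eqP <- _ _ _ /andP[/allP esE /forallP inc].
exists (tnth es (Ordinal l0)); first exact: (esE _ (mem_tnth _ _)).
rewrite /thead (_ : ord0 = widen_ord (leqnSn l) (Ordinal l0)).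
  by have /andP[] := inc (Ordinal l0).
exact: val_inj.
Qed.

(** Either the minimum defining the distance is the length of a path, or it has
    its default value [n]; every path is shorter than [n], because its vertices
    are distinct. *)
Lemma hpath_short n k (G : uniform_hypergraph n k) (u v : 'I_n) :
  hconnected G -> exists2 l, has_hpath G u v l & (l <= distance G u v)%N.
Proof.
move=> conn; have : distance G u v = n \/ has_hpath G u v (distance G u v).
  rewrite /distance; elim/big_rec: _ => [|i m pi [->|pm]]; first by left.
    by case: leqP => _; [right | left].
  by right; case: leqP.
case=> [->|]; last by exists (distance G u v).
have [l pl] := conn u v; exists l => //; apply: ltnW.
have /existsP[vs /existsP[es /and5P[_ _ /card_uniqP vsU _ _]]] := pl.
by have := max_card (mem vs); rewrite vsU size_tuple card_ord.
Qed.

Lemma distance_le_diameter n k (G : uniform_hypergraph n k) (u v : 'I_n) :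
  u != v -> (distance G u v <= diameter G)%N.
Proof.
move=> uv; apply: leq_trans (leq_bigmax u).
by rewrite (bigD1 v) ?leq_maxl // eq_sym.
Qed.

(** The difference telescopes along the path, and since the edges of a path are
    distinct, the sum of [F] along it is part of the sum over all edges. *)
Lemma hpath_spread (R : realFieldType) n k (G : uniform_hypergraph n k)
    (z : 'I_n -> R) (F : {set 'I_n} -> R) (u v : 'I_n) l :
    (forall e, e \in edges G -> 0 <= F e) ->
    (forall e p q, e \in edges G -> p \in e -> q \in e ->
       (z p - z q) ^+ 2 <= F e) ->
  has_hpath G u v l ->
  (z u - z v) ^+ 2 <= l%:R * \sum_(e in edges G) F e.
Proof.
move=> F0 zF /existsP[vs /existsP[es]].
case/and5P => /eqP vsu /eqP vsv _ esU /andP[/allP esE /forallP inc].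
have {}esE e : e \in es -> e \in edges G := esE e.
pose f j := z (nth u vs j).
have zE : z u - z v = \sum_(i < l) (f i - f i.+1).
  rewrite -opprB -[X in _ = X]opprK -sumrN; congr (- _).
  under eq_bigr do rewrite opprB.
  rewrite -(big_mkord predT (fun i => f i.+1 - f i)) telescope_sumr //.
  have fu : f 0%N = z u by rewrite /f -[in RHS]vsu /thead (tnth_nth u).
  by rewrite fu /f -vsv (tnth_nth u).
rewrite zE; apply: le_trans (sqr_sum_le _) _; apply: ler_wpM2l => //.
apply: le_trans (_ : \sum_(i < l) F (tnth es i) <= _).
  apply: ler_sum => i _; have /andP[] := inc i.
  rewrite !(tnth_nth u) => pe qe; apply: zF pe qe.
  by exact: (esE _ (mem_tnth _ _)).
rewrite -(big_tuple _ _ es predT F) big_uniq //=.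
rewrite [leRHS](bigID (mem es)) /= [X in X + _](eq_bigl (mem es)); last first.
  by move=> e /=; case: (boolP (e \in es)) => [/esE ->|]; rewrite ?andbF.
by rewrite lerDl sumr_ge0 // => e /andP[/F0].
Qed.

Lemma irregular_pair n k (G : uniform_hypergraph n k) :
  irregular G -> exists i j, (degree G i < degree G j)%N.
Proof.
move=> irr; have [/existsP[i /existsP[j ij]]|none] :=
  boolP [exists i, exists j, degree G i < degree G j]%N.
  by exists i, j.
case: irr => i j; apply/eqP; rewrite eqn_leq.
by apply/andP; split; rewrite leqNgt; apply: contra none => lt; apply/existsP;
  [exists j | exists i]; apply/existsP; [exists i | exists j].
Qed.

Lemma degree_le n k (G : uniform_hypergraph n k) i :
  (degree G i <= max_degree G)%N.
Proof. exact: leq_bigmax. Qed.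

Lemma deficiency_sum (R : comRingType) n k (G : uniform_hypergraph n k) :
  n%:R * (max_degree G)%:R - k%:R * (size_hypergraph G)%:R =
  \sum_i ((max_degree G)%:R - (degree G i)%:R) :> R.
Proof. by rewrite sumrB sumr_const card_ord handshake_size mulr_natl. Qed.

Lemma deficiency_gt0 (R : realFieldType) n k (G : uniform_hypergraph n k) :
  irregular G ->
  0 < n%:R * (max_degree G)%:R - k%:R * (size_hypergraph G)%:R :> R.
Proof.
move=> /irregular_pair[i [j ij]]; rewrite deficiency_sum (bigD1 i) //=.
rewrite ltr_pwDl ?subr_gt0 ?ltr_nat ?(leq_trans ij (degree_le _ _)) //.
by apply: sumr_ge0 => p _; rewrite subr_ge0 ler_nat degree_le.
Qed.

(** Applied to the squares z i ^ 2, this writes the defect of the Rayleigh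
    quotient as a part due to low degrees plus a part due to variation inside
    the edges. *)
Lemma energy_split (R : realFieldType) n k (G : uniform_hypergraph n k)
    (z : 'I_n -> R) (P : {set 'I_n} -> R) :
  (max_degree G)%:R * \sum_i z i - \sum_(e in edges G) P e =
  \sum_i ((max_degree G)%:R - (degree G i)%:R) * z i
    + \sum_(e in edges G) (\sum_(i in e) z i - P e).
Proof.
rewrite sumrB addrA -handshake; congr (_ - _); rewrite -big_split mulr_sumr.
by apply: eq_bigr => i _ /=; ring.
Qed.

(** Only the edge [e0] is charged for the small value at [v]; every other
    product is at most 1.  The loss k (1 - w v ^ 2) of [e0] is at least
    1 - w v ^ k by Bernoulli's inequality.  This slack makes the final bound
    strict when the low-degree and variation parts balance exactly. *)
Lemma sum_prod_le (R : realFieldType) n k (G : uniform_hypergraph n k)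
    (w : 'I_n -> R) (e0 : {set 'I_n}) (v : 'I_n) :
    (0 < k)%N -> (forall i, 0 <= w i <= 1) -> e0 \in edges G -> v \in e0 ->
  k%:R * \sum_(e in edges G) \prod_(i in e) w i ^+ 2 <=
    k%:R * (size_hypergraph G)%:R - (1 - w v ^+ k).
Proof.
move=> k0 w01 e0E ve0.
have sq01 i : 0 <= w i ^+ 2 <= 1.
  by have /andP[a b] := w01 i; rewrite exprn_ge0 ?exprn_ile1.
have prod_le1 (A : {pred 'I_n}) : \prod_(i in A) w i ^+ 2 <= 1.
  exact: prodr_ile1.
have bern : 1 - w v ^+ k <= k%:R * (1 - w v ^+ 2).
  have /andP[a b] := w01 v.
  have : 1 - w v ^+ k <= k%:R * (1 - w v).
    rewrite -opprB subrX1 -mulNr opprB mulrC ler_wpM2r ?subr_ge0 //.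
    rewrite -[k in k%:R]card_ord -sumr_const; apply: ler_sum => i _.
    by rewrite exprn_ile1.
  by move/le_trans; apply; rewrite ler_wpM2l //; nra.
have edge0 : \prod_(i in e0) w i ^+ 2 <= w v ^+ 2.
  rewrite (big_setD1 v) //= ler_piMr ?exprn_ge0 //; by have /andP[] := w01 v.
have others : \sum_(e in edges G :\ e0) \prod_(i in e) w i ^+ 2 <=
    (size_hypergraph G)%:R - 1.
  rewrite /size_hypergraph (cardsD1 e0) e0E natrD addrAC subrr add0r.
  by rewrite -sumr_const; apply: ler_sum => e _.
rewrite (big_setD1 e0) //=.
have -> : k%:R * (size_hypergraph G)%:R - (1 - w v ^+ k) =
  k%:R * (w v ^+ 2 + ((size_hypergraph G)%:R - 1))
  + (k%:R * (1 - w v ^+ 2) - (1 - w v ^+ k)) by ring.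
by apply: ler_wpDr; rewrite ?subr_ge0 // ler_wpM2l // lerD.
Qed.

(** * Optimisation in one variable *)

(** The difference of the two sides is the square of
    B t - K - c S / (2 B m), multiplied by m / c. *)
Lemma slack_le (R : realFieldType) (S c m B K t : R) :
    0 < S -> 0 < c -> 1 <= m -> 1 <= B -> B = c * S + K -> t <= 1 ->
  c * S ^+ 2 / B - c * S ^+ 2 / (4 * B ^+ 2 * m) <=
    m / c * (B * t - K) ^+ 2 + S * (1 - t).
Proof.
move=> S0 c0 m1 B1 BE t1.
have B0 : 0 < B by lra. have m0 : 0 < m by lra.
rewrite -subr_ge0.
have -> : K = B - c * S by rewrite BE; ring.
set D := (X in 0 <= X).
have -> : D = m / c * (B * t - (B - c * S) - c * S / (2 * B * m)) ^+ 2.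
  by rewrite /D; field; rewrite !gt_eqF.
by rewrite mulr_ge0 ?sqr_ge0 // divr_ge0 // ltW.
Qed.

Lemma slack_gt0 (R : realFieldType) (S c m B : R) :
    0 < S -> 0 < c -> 1 <= m -> 1 <= B ->
  0 < c * S ^+ 2 / B - c * S ^+ 2 / (4 * B ^+ 2 * m).
Proof.
move=> S0 c0 m1 B1.
have B0 : 0 < B by lra. have m0 : 0 < m by lra.
have -> : c * S ^+ 2 / B - c * S ^+ 2 / (4 * B ^+ 2 * m) =
   c * S ^+ 2 * (4 * B * m - 1) / (4 * B ^+ 2 * m).
  by field; rewrite !gt_eqF.
rewrite divr_gt0 ?mulr_gt0 ?exprn_gt0 //; nra.
Qed.

(** This is the scalar content of the theorem, with [T] the sum of squares, [g]
    the edge form, [t] the least value and [phi] the variation part of the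
    energy.  The hypotheses on the energy and on [phi] bound Delta T - g below
    by S t^2 + K / c (1 - t)^2, whose minimum in [t] is S K / B; together with
    g <= K m this gives the bound on g / T.  At the minimiser t = K / B < 1 the
    last hypothesis improves on g <= K m, and elsewhere S K / B is exceeded, so
    a positive [delta] common to all data remains. *)
Lemma linear_bound (R : realFieldType) (S c m K Delta : R) :
    let B := c * S + K in
    0 < S -> 0 < c -> 1 <= m -> 1 <= K ->
  exists2 delta, 0 < delta & forall g T phi t : R,
    t <= 1 ->
    S * t ^+ 2 + phi <= Delta * T - g ->
    K * (1 - t) ^+ 2 <= c * phi ->
    g <= K * m - (1 - t) ->
    g * (m * B + S) + delta <= m * B * Delta * T.
Proof.
move=> B S0 c0 m1 K1.
have cS0 : 0 < c * S by rewrite mulr_gt0.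
have B1 : 1 <= B by rewrite /B; lra.
exists (c * S ^+ 2 / B - c * S ^+ 2 / (4 * B ^+ 2 * m)).
  exact: slack_gt0.
move=> g T phi t t1 energy phit gm.
have := @slack_le _ S c m B K t S0 c0 m1 B1 erefl t1; set delta := _ - _ => slk.
have {}phit : K / c * (1 - t) ^+ 2 <= phi.
  by rewrite mulrAC ler_pdivrMr // [leRHS]mulrC.
have e1 : 0 <= m * B * (Delta * T - g - S * t ^+ 2 - phi).
  by rewrite !mulr_ge0 //; lra.
have e2 : 0 <= m * B * (phi - K / c * (1 - t) ^+ 2).
  by rewrite !mulr_ge0 //; lra.
have e3 : 0 <= S * (K * m - (1 - t) - g) by rewrite mulr_ge0 //; lra.
(* Completing the square: K / c + S = B / c. *)
have square : m * B * (S * t ^+ 2 + K / c * (1 - t) ^+ 2) - S * K * m =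
    m / c * (B * t - K) ^+ 2.
  by rewrite /B; field; rewrite gt_eqF.
lra.
Qed.

(** * Uniform bound on the Rayleigh quotient *)

Lemma irregular_exists_neq n k (G : uniform_hypergraph n k) (v : 'I_n) :
  irregular G -> exists u, v != u.
Proof.
move=> /irregular_pair[i [j]]; have [<- ij|vi _] := eqVneq v i.
  by exists j; apply: contraTneq ij => <-; rewrite ltnn.
by exists i.
Qed.

Lemma vertex_in_edge n k (G : uniform_hypergraph n k) (v : 'I_n) :
  irregular G -> hconnected G -> exists2 e, e \in edges G & v \in e.
Proof.
move=> irr conn; have [u vu] := irregular_exists_neq v irr.
by have [l pl] := conn v u; exact: hpath_edge vu pl.
Qed.

Lemma size_gt0 n k (G : uniform_hypergraph n k) :
  irregular G -> hconnected G -> (0 < size_hypergraph G)%N.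
Proof.
move=> irr conn; have [i _] := irregular_pair irr.
have [e eE _] := vertex_in_edge i irr conn.
by apply/card_gt0P; exists e.
Qed.

Lemma diameter_gt0 n k (G : uniform_hypergraph n k) :
  irregular G -> hconnected G -> (0 < diameter G)%N.
Proof.
move=> irr conn; have [i _] := irregular_pair irr.
have [u iu] := irregular_exists_neq i irr.
have [l pl ld] := hpath_short i u conn.
apply: leq_trans (distance_le_diameter G iu).
exact: leq_trans (hpath_gt0 iu pl) ld.
Qed.

(** The least value [t] of [linear_bound] is w v ^ k at a vertex [v] where [w]
    is minimal; a shortest path from [u] to [v] relates it to the maximum 1. *)
Lemma normalized_bound (R : realFieldType) n k (G : uniform_hypergraph n k) :
    let m : R := (size_hypergraph G)%:R in
    let Delta : R := (max_degree G)%:R in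
    let S : R := n%:R * Delta - k%:R * m in
    let c : R := 2 * (k%:R - 1) * (diameter G)%:R in
    let B := c * S + k%:R in
    (2 <= k)%N -> irregular G -> hconnected G ->
  exists2 delta, 0 < delta & forall (w : 'I_n -> R) (u : 'I_n),
    (forall i, 0 <= w i <= 1) -> w u = 1 ->
    k%:R * (\sum_(e in edges G) \prod_(i in e) w i ^+ 2) * (m * B + S) + delta
      <= m * B * Delta * \sum_i (w i ^+ k) ^+ 2.
Proof.
move=> m Delta S c B hk irr conn.
have k1 : 1 < k%:R :> R by rewrite ltr1n.
have K0 : 0 < k%:R :> R by lra.
have S0 : 0 < S by exact: deficiency_gt0.
have m1 : 1 <= m by rewrite ler1n; exact: size_gt0.
have D1 : 1 <= (diameter G)%:R :> R by rewrite ler1n; exact: diameter_gt0.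
have c0 : 0 < c by rewrite /c !mulr_gt0 //; lra.
have [delta delta0 linear] := linear_bound Delta S0 c0 m1 (ltW k1).
exists delta => // w u w01 wu1.
have w0 i : 0 <= w i by have /andP[] := w01 i.
pose v := [arg min_(i < u) w i]%O.
have vmin i : w v <= w i.
  by rewrite /v; case: arg_minP => // j _; exact.
have [e0 e0E ve0] := vertex_in_edge v irr conn.
pose z i := w i ^+ k.
pose gap (e : {set 'I_n}) :=
  \sum_(i in e) z i ^+ 2 - k%:R * \prod_(i in e) w i ^+ 2.
have gapP e p q : e \in edges G -> p \in e -> q \in e ->
    (z p - z q) ^+ 2 <= 2 * (k%:R - 1) / k%:R * gap e.
  move=> eE pe qe; have := edge_gap w0 _ pe qe.
  rewrite (card_edge eE) => /(_ hk) H.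
  by rewrite mulrAC ler_pdivlMr 1?mulrC.
have gap0 e : e \in edges G -> 0 <= 2 * (k%:R - 1) / k%:R * gap e.
  move=> eE; have /card_gt0P[p pe] : (0 < #|e|)%N.
    by rewrite (card_edge eE) ltnW.
  by apply: le_trans (gapP e p p eE pe pe); rewrite sqr_ge0.
pose phi := \sum_(e in edges G) gap e.
apply: (linear _ _ phi (w v ^+ k)).
- by rewrite exprn_ile1 //; have /andP[] := w01 v.
- rewrite [X in _ - X]mulr_sumr energy_split lerD2r /S deficiency_sum mulr_suml.
  apply: ler_sum => i _; rewrite ler_wpM2l ?subr_ge0 ?ler_nat ?degree_le //.
  by rewrite !lerXn2r ?nnegrE ?exprn_ge0.
- have spread : (1 - w v ^+ k) ^+ 2 <= (diameter G)%:R *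
      \sum_(e in edges G) 2 * (k%:R - 1) / k%:R * gap e.
    have [uv|uv] := eqVneq u v.
      by rewrite -uv wu1 expr1n subrr expr0n mulr_ge0 // sumr_ge0.
    have [l pl ld] := hpath_short u v conn.
    have := hpath_spread gap0 gapP pl; rewrite /z wu1 expr1n.
    move/le_trans; apply; rewrite ler_wpM2r ?sumr_ge0 // ler_nat.
    exact: leq_trans ld (distance_le_diameter G uv).
  have := ler_wpM2l (ltW K0) spread; rewrite -mulr_sumr -/phi.
  by rewrite [leRHS](_ : _ = c * phi) // /c; field; rewrite gt_eqF.
- by apply: sum_prod_le e0E ve0 => //; exact: leq_trans hk.
Qed.

(** Both sides are homogeneous of degree 2 k in [w], so [w] may be scaled to
    have maximum 1.  Then the sum of squares is at most [n], which turns the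
    additive gap of [normalized_bound] into a gap [eps] in the coefficient. *)
Lemma rayleigh_bound (R : realFieldType) n k (G : uniform_hypergraph n k) :
    let m : R := (size_hypergraph G)%:R in
    let Delta : R := (max_degree G)%:R in
    let S : R := n%:R * Delta - k%:R * m in
    let c : R := 2 * (k%:R - 1) * (diameter G)%:R in
    let B := c * S + k%:R in
    (2 <= k)%N -> irregular G -> hconnected G ->
  exists2 eps, 0 < eps & forall w : 'I_n -> R,
    (forall i, 0 <= w i) -> (exists i, w i != 0) ->
    k%:R * (\sum_(e in edges G) \prod_(i in e) w i ^+ 2) * (m * B + S)
      <= (m * B * Delta - eps) * \sum_i (w i ^+ k) ^+ 2.
Proof.
move=> m Delta S c B hk irr conn.
have [delta delta0] := normalized_bound R hk irr conn.
rewrite /= -/m -/Delta -/S -/c -/B => normalized.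
have n0 : 0 < n%:R :> R.
  by have [i _] := irregular_pair irr; rewrite ltr0n (leq_trans _ (ltn_ord i)).
exists (delta / n%:R) => [|w w0 [i0 wi0]]; first by rewrite divr_gt0.
pose u := [arg max_(i > i0) w i]%O.
have umax i : w i <= w u.
  by rewrite /u; case: arg_maxP => // j _; exact.
have wu0 : 0 < w u.
  by rewrite (lt_le_trans _ (umax i0)) // lt_def wi0 w0.
pose w' i := w i / w u.
have w01 i : 0 <= w' i <= 1.
  by rewrite /w' divr_ge0 //= ler_pdivrMr // mul1r.
have w'u : w' u = 1 by rewrite /w' divff // gt_eqF.
have wE i : w i = w u * w' i by rewrite mulrC divfK // gt_eqF.
have TE : \sum_i (w i ^+ k) ^+ 2 = (w u ^+ k) ^+ 2 * \sum_i (w' i ^+ k) ^+ 2.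
  by rewrite mulr_sumr; apply: eq_bigr => i _; rewrite [in LHS]wE !exprMn.
have gE : \sum_(e in edges G) \prod_(i in e) w i ^+ 2 =
    (w u ^+ k) ^+ 2 * \sum_(e in edges G) \prod_(i in e) w' i ^+ 2.
  rewrite mulr_sumr; apply: eq_bigr => e eE.
  rewrite -exprM mulnC exprM -[in RHS](card_edge eE) -prodr_const -big_split.
  by apply: eq_bigr => i _ /=; rewrite [in LHS]wE exprMn.
have := normalized w' u w01 w'u.
have Tn : \sum_i (w' i ^+ k) ^+ 2 <= n%:R.
  rewrite -[n in n%:R]card_ord -sumr_const; apply: ler_sum => i _.
  by have /andP[? ?] := w01 i; rewrite !exprn_ile1 ?exprn_ge0.
rewrite TE gE.
set g' := \sum_(e in _) _; set T' := \sum_i _ in Tn *; set a := (w u ^+ k) ^+ 2.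
move=> bound.
have dT : delta / n%:R * T' <= delta.
  by rewrite mulrAC ler_pdivrMr // ler_pM2l.
have a0 : 0 < a by rewrite !exprn_gt0.
rewrite [leLHS](_ : _ = a * (k%:R * g' * (m * B + S))); last by ring.
rewrite [leRHS](_ : _ = a * ((m * B * Delta - delta / n%:R) * T'));
  last by ring.
by rewrite ler_pM2l // mulrBl; lra.
Qed.

(** Taking for [w] the square roots of the moduli |x_i| makes both the products
    of the |x_i| and the powers |x_i|^(k/2) polynomials in [w], so that later
    steps need no fractional powers. *)
Lemma eigenvalue_normc_le (R : realType) n k (G : uniform_hypergraph n k)
    (lam : R[i]) : (0 < k)%N ->
  tensor_eigenvalue (adjacency_tensor R[i] G) lam ->
  exists2 w : 'I_n -> R, (forall i, 0 <= w i) /\ (exists i, w i != 0) &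
    Normc.normc lam * \sum_i (w i ^+ k) ^+ 2 <=
    k%:R * \sum_(e in edges G) \prod_(i in e) w i ^+ 2.
Proof.
move=> k0 [x x0 /(eigenvalue_norm_le k0) bound].
have normE (y : R[i]) : `|y| = (Normc.normc y)%:C%C by case: y.
have norm0 (y : R[i]) : 0 <= Normc.normc y by case: y => *; exact: sqrtr_ge0.
exists (fun i => Num.sqrt (Normc.normc (x i 0))).
  split=> [i|]; first exact: sqrtr_ge0.
  have [i xi] : exists i, x i 0 != 0.
    apply/existsP; apply: contraNT x0 => /existsPn xz.
    apply/eqP/matrixP => i j; rewrite ord1 mxE; apply/eqP.
    exact: negbNE (xz i).
  exists i; rewrite gt_eqF // sqrtr_gt0 lt_def norm0 andbT.
  by apply: contraNneq xi => /Normc.eq0_normc ->.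
move: bound; under eq_bigr do rewrite normE -rmorphXn.
under [X in _ <= _ * X]eq_bigr => e _.
  under eq_bigr do rewrite normE.
  rewrite -rmorph_prod; over.
rewrite normE -!rmorph_sum -(rmorph_nat (real_complex R)) -!rmorphM lecR.
congr (_ * _ <= _ * _).
  by apply: eq_bigr => i _; rewrite exprAC sqr_sqrtr.
by apply: eq_bigr => e _; apply: eq_bigr => i _; rewrite sqr_sqrtr.
Qed.

(** * Spectral radius *)

Theorem theorem3p7 (R : realType) (n k : nat) (G : uniform_hypergraph n k)
    (hk : (2 <= k)%N) (hirr : irregular G) (hconn : hconnected G) :
  let N : R := n%:R in
  let K : R := k%:R in
  let m : R := (size_hypergraph G)%:R in
  let Delta : R := (max_degree G)%:R in
  let D : R := (diameter G)%:R in
  spectral_radius R G <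
    (2 * m * Delta * (K - 1) * D * (N * Delta - K * m) + K * m * Delta)
    / (2 * m * (K - 1) * D * (N * Delta - K * m) + N * Delta).
Proof.
cbv zeta.
set N : R := n%:R; set K : R := k%:R; set m : R := (size_hypergraph G)%:R.
set Delta : R := (max_degree G)%:R; set D : R := (diameter G)%:R.
have [eps eps0] := rayleigh_bound R hk hirr hconn.
rewrite /= -/N -/K -/m -/Delta -/D.
set S := N * Delta - K * m; set B := _ * S + K => rayleigh.
have -> : 2 * m * Delta * (K - 1) * D * S + K * m * Delta = m * B * Delta.
  by rewrite /B; ring.
have -> : 2 * m * (K - 1) * D * S + N * Delta = m * B + S.
  by rewrite /B /S; ring.
have S0 : 0 < S by exact: deficiency_gt0.
have m0 : 0 < m by rewrite ltr0n; exact: size_gt0.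
have K1 : 1 < K by rewrite ltr1n.
have B0 : 0 < B.
  apply: ltr_wpDl; last exact: lt_trans K1.
  have K1' : 0 <= K - 1 by rewrite subr_ge0 ltW.
  by rewrite !mulr_ge0 ?ler0n // ltW.
have mBS : 0 < m * B + S by rewrite addr_gt0 ?mulr_gt0.
have Delta0 : 0 < Delta.
  have [i [j ij]] := irregular_pair hirr.
  by rewrite ltr0n (leq_trans _ (degree_le G j)) // (leq_ltn_trans _ ij).
rewrite /spectral_radius; set E := (X in sup X).
(* An empty supremum is 0 by convention, which is below the positive bound. *)
have [E0|E0] := EM (classical_sets.nonempty E); last first.
  by rewrite sup_out => [|[]//]; rewrite divr_gt0 ?mulr_gt0.
apply: le_lt_trans (_ : (m * B * Delta - eps) / (m * B + S) < _).
  apply: ge_sup E0 _ => _ [lam ev ->].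
  have [w [w0 wn0] lamw] := eigenvalue_normc_le (ltnW hk) ev.
  have := rayleigh w w0 wn0.
  have T0 : 0 < \sum_i (w i ^+ k) ^+ 2.
    have [i wi] := wn0; rewrite (bigD1 i) //= ltr_pwDl ?sumr_ge0 //.
      by rewrite !exprn_gt0 // lt_def wi w0.
    by move=> j _; rewrite sqr_ge0.
  move=> bound; rewrite ler_pdivlMr // -(ler_pM2r T0).
  apply: le_trans bound.
  by rewrite mulrAC ler_wpM2r // ltW.
by rewrite ltr_pM2r ?invr_gt0 // ltrBlDr ltrDl.
Qed.
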